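(* Let $m,k,s\in\mathbb{N}$ with $1\le k\le m-1$ and $\gcd(m,s)=1$, let $\Gamma=\langle m,m+s,\ldots,m+ks\rangle$, and let $S_{m,k}^s=S_\Gamma^s$ be the corresponding arithmetical Leamer monoid. Then $$\Delta(S_{m,k}^s)=\left\{1,\ldots,\left\lfloor\tfrac{m-2}{k}\right\rfloor+1\right\}.$$
   Context: $\mathbb{N}$ contains $0$; $\langle\cdot\rangle$ denotes the additive submonoid of $\mathbb{N}$ generated by the listed elements. For a numerical monoid $\Gamma$ (additive submonoid of $\mathbb{N}$ with finite complement) and $s\in\mathbb{N}\setminus\Gamma$, the Leamer monoid is $$S_\Gamma^s=\{(0,0)\}\cup\{(x,n): n\ge 1,\ \{x,x+s,x+2s,\ldots,x+ns\}\subset\Gamma\}\subset\mathbb{N}^2,$$ a monoid under componentwise addition. An atom (irreducible element) is a nonzero element that is not a sum of two nonzero elements of $S_\Gamma^s$; $\mathcal{A}(S_\Gamma^s)$ is the set of atoms. The set of lengths of $(x,n)\in S_\Gamma^s$ is $\mathcal{L}(x,n)=\{r : (x,n)=\sum_{i=1}^r (x_i,n_i),\ (x_i,n_i)\in\mathcal{A}(S_\Gamma^s)\}$. Writing $\mathcal{L}(x,n)=\{\ell_1<\cdots<\ell_t\}$, the Delta set of $(x,n)$ is $\Delta(x,n)=\{\ell_i-\ell_{i-1}: 2\le i\le t\}$, and $\Delta(S_\Gamma^s)=\bigcup_{(x,n)\in S_\Gamma^s}\Delta(x,n)$. *)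

(* Defs.v *)
From HB Require Import structures.
From mathcomp Require Import all_boot all_order all_algebra.
From mathcomp Require Import boolp classical_sets functions cardinality.

Set Implicit Arguments.
Unset Strict Implicit.
Unset Printing Implicit Defensive.

Local Open Scope classical_set_scope.

Section Factorizations.
Variable M : nmodType.
Implicit Types S : set M.
Local Open Scope ring_scope.

Definition submonoid S := S 0 /\ forall x y, S x -> S y -> S (x + y).

Definition generated_submonoid (A : set M) : set M := smallest submonoid A.

Definition atoms S : set M :=
  [set x | [/\ S x, x <> 0 &
    ~ exists y z, [/\ S y, S z, y <> 0, z <> 0 & x = y + z]]].

Definition lengths S (x : M) : set nat :=
  [set r | exists2 f : 'I_r -> M,
    (forall i, atoms S (f i)) & x = \sum_(i < r) f i].

(* Differences of consecutive elements of the set of lengths. *)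
Definition delta_elt S (x : M) : set nat :=
  [set d | exists l l' : nat,
    [/\ lengths S x l, lengths S x l', (l < l')%N,
        (forall j, (l < j < l')%N -> ~ lengths S x j) & d = (l' - l)%N]].

Definition delta_set S : set nat := \bigcup_(x in S) delta_elt S x.

End Factorizations.

Definition numerical_monoid (G : set nat) :=
  submonoid G /\ finite_set (~` G).

(* Meant for a numerical monoid G and s \notin G; see arith_monoid_numerical
   and arith_monoid_step below. *)
Definition leamer (G : set nat) (s : nat) : set (nat * nat) :=
  [set p | p = (0, 0) \/
    (1 <= p.2 /\ forall i, i <= p.2 -> G (p.1 + i * s))].

Definition arith_monoid (m k s : nat) : set nat :=
  generated_submonoid [set m + i * s | i in [set i | i <= k]].

Definition arith_leamer (m k s : nat) : set (nat * nat) :=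
  leamer (arith_monoid m k s) s.

Lemma generated_submonoidP (M : nmodType) (A : set M) :
  submonoid (generated_submonoid A).
Proof.
split=> [S [[S0 _] _] //|x y Ax Ay S [Smon AS]].
by apply: (proj2 Smon); [apply: Ax|apply: Ay].
Qed.

Lemma submonoid_mul (G : set nat) a n : submonoid G -> G a -> G (n * a).
Proof.
by move=> [G0 GD] Ga; elim: n => [|n IHn]; [exact: G0 | rewrite mulSn; exact: GD].
Qed.

Lemma leamer_submonoid (G : set nat) s :
  submonoid G -> submonoid (leamer G s).
Proof.
move=> [G0 GD]; split=> [|[x a] [y b]]; first by left.
case=> [[-> ->]|[/= a1 Ga]]; first by [].
case=> [[-> ->]|[/= b1 Gb]].
  by right; split; rewrite /= ?[GRing.add _ _]addn0.
right; split=> [|i /= le_i]; first by rewrite /= ltn_addr.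
have [le_ia|lt_ai] := leqP i a.
  have -> : GRing.add x y + i * s = (x + i * s) + (y + 0 * s).
    by rewrite mul0n addn0 addnAC.
  by apply: GD; [exact: Ga | exact: Gb].
have -> : GRing.add x y + i * s = (x + a * s) + (y + (i - a) * s).
  by rewrite addnACA -mulnDl subnKC // ltnW.
by apply: GD; [exact: Ga | apply: Gb; rewrite leq_subLR].
Qed.

Lemma arith_monoid_numerical m k s :
  1 <= k <= m - 1 -> coprime m s -> numerical_monoid (arith_monoid m k s).
Proof.
move=> /andP[k1 km] cop; split; first exact: generated_submonoidP.
have m1 : 0 < m by move: (leq_trans k1 km); case: (m).
have mon : submonoid (arith_monoid m k s) by exact: generated_submonoidP.
have Gm : arith_monoid m k s m.
  by apply: sub_gen_smallest; exists 0; rewrite //= mul0n addn0.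
have Gms : arith_monoid m k s (m + s).
  by apply: sub_gen_smallest; exists 1; rewrite //= mul1n.
apply: (@sub_finite_set _ _ `I_(m * (m + s))); last exact: finite_II.
move=> x /= Gx; rewrite ltnNge; apply/negP => le_x; apply: Gx.
pose i := (chinese m (m + s) x 0 %/ (m + s)) %% m.
have cop' : coprime m (m + s) by rewrite -coprime_modr modnDl coprime_modr.
have dvd : m + s %| chinese m (m + s) x 0.
  by rewrite /dvdn chinese_modr // mod0n.
have eq_i : i * (m + s) = x %[mod m].
  by rewrite /i -modnMml modn_mod modnMml divnK // chinese_modl.
have le_i : i * (m + s) <= x.
  by apply: leq_trans le_x; rewrite leq_mul2r ltnW ?ltn_pmod ?orbT.
have /eqP := esym eq_i; rewrite eqn_mod_dvd // => /dvdnP[j def_j].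
have -> : x = i * (m + s) + j * m by rewrite -def_j subnKC.
by apply: (proj2 mon); [exact: submonoid_mul mon Gms | exact: submonoid_mul mon Gm].
Qed.

Lemma arith_monoid_step m k s :
  1 <= k <= m - 1 -> coprime m s -> ~ arith_monoid m k s s.
Proof.
move=> /andP[k1 km] cop Gs.
have m1 : 1 < m by move: (leq_trans k1 km); rewrite subn_gt0.
have : m %| s \/ s < s.
  apply: (Gs [set x | m %| x \/ s < x]); split.
    split=> [|x y]; first by left; rewrite dvdn0.
    move=> /= [dx|lx] [dy|ly].
    - by left; exact: dvdn_add.
    - by right; exact: (leq_trans ly (leq_addl _ _)).
    - by right; exact: (leq_trans lx (leq_addr _ _)).
    - by right; exact: (leq_trans lx (leq_addr _ _)).
  move=> _ [[|i] _ <-] /=; first by left; rewrite mul0n addn0.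
  right; rewrite mulSn addnCA -[X in X < _]addn0 ltn_add2l.
  by rewrite addn_gt0 (ltnW m1).
rewrite ltnn; case=> // /gcdn_idPl eq_m.
by move: cop m1; rewrite /coprime eq_m => /eqP ->.
Qed.

(* Main.v *)
Require Import Defs.
From mathcomp Require Import all_boot all_order all_algebra.
From mathcomp Require Import boolp classical_sets.
From mathcomp Require Import zify.

(* Write x = a m + i s with 0 <= i < m, call a the level, and let
   c = floor((m-2)/k) + 1 = ceil((m-1)/k). Then (x, n) lies in the Leamer monoid
   iff i + n <= k a or a >= c, and its atoms are those with a = 1, those with
   n = 1, and the "big" ones with a = c and i + n > k c.

   Gaps are at most c. Let l' be the larger of two consecutive lengths. If a
   factorization of length l' >= 3 contains a big atom, two other factors y, z
   merge into (x_y + x_z, 1), the big atom absorbing the rest of the second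
   coordinate; so l' - 1 is a length. Without big atom, either n is at most
   1 + k (l' - 2), and one atom with n = 1 plus l' - 2 atoms of level 1 give
   length l' - 1, or n is so large that a big atom plus l' - c - 1 atoms with
   n = 1 give length l' - c.

   The gap d in {1, ..., c} occurs between the lengths 2 and d + 2 of the
   element of level c + 2 with i = k (c - d) and n = k d + 2. *)

Local Open Scope classical_set_scope.

(** * Factorizations as sequences of atoms *)

Section Lengths.
Local Set Implicit Arguments.
Local Unset Strict Implicit.
Variables (M : nmodType) (S : set M).
Local Open Scope ring_scope.

Lemma lengthsP (x : M) r :
  lengths S x r <-> exists t : seq M,
    [/\ forall p, p \in t -> atoms S p, size t = r & x = \sum_(p <- t) p].
Proof.
split=> [[f fA ->]|[t [tA <- ->]]].
  exists [seq f i | i <- enum 'I_r]; split.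
  - by move=> p /mapP[i _ ->].
  - by rewrite size_map size_enum_ord.
  - by rewrite big_map big_enum.
exists (fun i => nth 0 t i); last by rewrite (big_nth 0) big_mkord.
by move=> i; apply/tA/mem_nth.
Qed.

Lemma lengths0 : lengths S 0 0.
Proof. by apply/lengthsP; exists [::]; rewrite big_nil. Qed.

Lemma lengths_cons (p x : M) r :
  atoms S p -> lengths S x r -> lengths S (p + x) r.+1.
Proof.
move=> pA /lengthsP[t [tA <- ->]]; apply/lengthsP; exists (p :: t).
split=> [q||]; rewrite ?big_cons // inE => /orP[/eqP->//|]; exact: tA.
Qed.

Lemma lengths1 (p : M) : atoms S p -> lengths S p 1.
Proof. by move=> pA; rewrite -[p]GRing.addr0; exact/lengths_cons/lengths0. Qed.

Lemma lengths_muln (p x : M) r q :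
  atoms S p -> lengths S x r -> lengths S (p *+ q + x) (q + r)%N.
Proof.
move=> pA xr; elim: q => [|q IHq]; first by rewrite GRing.mulr0n GRing.add0r.
by rewrite GRing.mulrS -GRing.addrA addSn; exact: lengths_cons.
Qed.

End Lengths.

(** Used with [I] = i and [J] = i + n, to split an element into one of level 1 and a remainder of
    level a - 1, where [K] = k (a - 1). *)
Lemma interval_split k K r I J : 0 < k -> r <= K -> I + r + 1 <= J <= k + K ->
  exists i1 j1 i2 j2,
    [/\ I = i1 + i2, J = j1 + j2, i1 < j1 <= k & i2 + r <= j2 <= K].
Proof.
move=> k0 rK IJ.
pose i2 := minn I (K - r); pose j1 := minn k (J - i2 - r).
exists (I - i2), j1, i2, (J - j1); rewrite /j1 /i2.
by split; lia.
Qed.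

(** * Levels and membership in the Leamer monoid *)

Section ArithmeticalLeamer.
Local Set Implicit Arguments.
Local Unset Strict Implicit.
Variables m k s : nat.
Hypotheses (hk : 1 <= k <= m - 1) (hms : coprime m s).

Let c := (m - 2) %/ k + 1.
Let S := arith_leamer m k s.

(* The pairs (a, i) representing a given x differ by multiples of (s, -m), so
   the one with i < m has the largest level a. *)
Let el a i n : nat * nat := (a * m + i * s, n).

Let k_gt0 : 0 < k. Proof. by case/andP: hk. Qed.
Let lt_km : k < m. Proof. lia. Qed.
Let s_gt0 : 0 < s.
Proof. by case: (s) hms => //; rewrite /coprime gcdn0; lia. Qed.

(** So [c] is the first level whose bound i <= k a admits every residue i < m. *)
Let le_crit a : (c <= a) = (m - 1 <= k * a).
Proof.
by rewrite /c addn1 ltn_divLR // mulnC; lia.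
Qed.

Let crit_gt0 : 0 < c. Proof. by rewrite /c addn1. Qed.

Let crit_ge : m <= k * c + 1.
Proof. by have := le_crit c; rewrite leqnn; lia. Qed.

Let crit_le : k * c + 2 <= m + k.
Proof. by rewrite /c mulnDr muln1 mulnC; have := leq_trunc_div (m - 2) k; lia. Qed.

Lemma elD a i n a' i' n' :
  (el a i n + el a' i' n' = el (a + a') (i + i') (n + n'))%R.
Proof. by rewrite /el; congr pair; rewrite !mulnDl addnACA. Qed.

Lemma el_inj a i n a' i' n' : i < m -> el a i n = el a' i' n' ->
  exists w, [/\ i' = i + w * m, a = a' + w * s & n = n'].
Proof.
move=> im [eq_x ->]; exists (i' %/ m).
have eq_i : i' %% m = i.
  have : i * s == i' * s %[mod m].
    by rewrite -(modnMDl a) -(modnMDl a' (i' * s)) eq_x.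
  have [le|/ltnW le] := leqP i i'.
    rewrite eq_sym eqn_mod_dvd ?leq_mul2r ?le ?orbT // -mulnBl Gauss_dvdl //.
    by rewrite -eqn_mod_dvd // => /eqP ->; rewrite modn_small.
  rewrite eqn_mod_dvd ?leq_mul2r ?le ?orbT // -mulnBl Gauss_dvdl //.
  by rewrite -eqn_mod_dvd // => /eqP <-; rewrite modn_small.
have def_i' : i' = i + i' %/ m * m by rewrite addnC -eq_i -divn_eq.
split=> //; apply/eqP; rewrite -(@eqn_pmul2r m); last by lia.
move: eq_x; rewrite [in i' * s]def_i'; nia.
Qed.

Lemma arith_monoidP x : arith_monoid m k s x <->
  exists a i, x = a * m + i * s /\ i <= k * a.
Proof.
split=> [|[a [i [-> le_i]]]].
  move=> Gx; apply: (Gx [set x | exists a i, x = a * m + i * s /\ i <= k * a]).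
  split; last by move=> _ [i le_i <-]; exists 1, i; rewrite mul1n muln1.
  split; first by exists 0, 0.
  move=> _ _ [a [i [-> le_i]]] [b [j [-> le_j]]].
  by exists (a + b), (i + j); split; [rewrite !mulnDl addnACA | lia].
elim: a i le_i => [|a IHa] i le_i.
  have -> : i = 0 by lia.
  by apply: (proj1 (generated_submonoidP _)).
have -> : a.+1 * m + i * s =
  (m + minn i k * s) + (a * m + (i - minn i k) * s).
  by rewrite mulSn addnACA -mulnDl subnKC ?geq_minl.
apply: (proj2 (generated_submonoidP _)); last by apply: IHa; lia.
by apply: sub_gen_smallest; exists (minn i k) => //=; exact: geq_minr.
Qed.

Lemma leamer_el a i n :
  0 < n -> i + n <= k * a \/ c <= a -> S (el a i n).
Proof.
move=> n0 h; right; split=> //= j jn; apply/arith_monoidP.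
case: h => [h|ca].
  by exists a, (i + j); split; [rewrite mulnDl addnA | lia].
(* Trading m copies of s for s copies of m leaves a residue below m, allowed from level [c] on. *)
exists (a + (i + j) %/ m * s), ((i + j) %% m); split.
  rewrite -addnA -mulnDl {1}(divn_eq (i + j) m); lia.
have : (i + j) %% m < m by rewrite ltn_pmod; lia.
move: ca; rewrite le_crit mulnDr.
by move: (_ %% m) (k * (_ * s)) => r b; lia.
Qed.

Lemma leamerP p : S p -> p <> 0%R ->
  exists a i n, [/\ p = el a i n, i < m, 0 < n, 0 < a &
    i + n <= k * a \/ c <= a].
Proof.
case: p => x n [[-> ->]|[/= n0 h] _]; first by [].
have /arith_monoidP[a0 [i0 [def_x le_i0]]] : arith_monoid m k s x.
  by have := h 0 isT; rewrite mul0n addn0.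
pose i := i0 %% m; pose a := a0 + i0 %/ m * s.
have im : i < m by rewrite ltn_pmod; lia.
have eq_x : x = a * m + i * s.
  by rewrite def_x {1}(divn_eq i0 m) /a /i; lia.
(* While i + j < m, level [a] is maximal among the representations of x + j s, so any representation
   in the monoid forces this bound. *)
have key j : j <= n -> i + j < m -> i + j <= k * a.
  move=> jn ijm; have /arith_monoidP[b [i' [eq_b le_i']]] := h j jn.
  have [|w [e1 e2 _]] := @el_inj a (i + j) 0 b i' 0 ijm.
    by congr pair; rewrite -eq_b eq_x mulnDl addnA.
  nia.
have h2 : i + n <= k * a \/ c <= a.
  have [lt|ge] := ltnP (i + n) m; first by left; apply: key.
  by right; rewrite le_crit; have := key (m - 1 - i); lia.
exists a, i, n; split=> //; first by rewrite /el eq_x.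
by case: h2 => h2; [nia | lia].
Qed.

(** * Classification of the atoms *)

Lemma el_neq0 a i n : 0 < n -> el a i n <> 0%R.
Proof. by move=> n0 [_ e]; rewrite e in n0. Qed.

Lemma atom_unit x : S (x, 1) -> atoms S (x, 1).
Proof.
move=> Sx; split=> // -[y [z [Sy Sz y0 z0]]].
have [a [i [n [-> _ n0 _ _]]]] := leamerP Sy y0.
have [b [j [q [-> _ q0 _ _]]]] := leamerP Sz z0.
by rewrite elD => -[_]; lia.
Qed.

Lemma atom_level1 i n : 0 < n -> i + n <= k -> atoms S (el 1 i n).
Proof.
move=> n0 le; split; [by apply: leamer_el=> //; lia | exact: el_neq0 |].
move=> [y [z [Sy Sz y0 z0]]].
have [a [i1 [n1 [-> _ _ a0 _]]]] := leamerP Sy y0.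
have [b [i2 [n2 [-> _ _ b0 _]]]] := leamerP Sz z0.
rewrite elD => /el_inj[|w [_ e _]]; lia.
Qed.

(** Two nonzero summands have positive levels of sum at most [c], so both lie below [c], and their
    bounds add up to at most k c. *)
Lemma atom_big i n : i < m -> 0 < n -> k * c < i + n -> atoms S (el c i n).
Proof.
move=> im n0 lt; split; [by apply: leamer_el=> //; right | exact: el_neq0 |].
move=> [y [z [Sy Sz y0 z0]]].
have [a [i1 [n1 [-> _ _ a0 h1]]]] := leamerP Sy y0.
have [b [i2 [n2 [-> _ _ b0 h2]]]] := leamerP Sz z0.
rewrite elD => /el_inj[//|w [e1 e2 e3]].
have {}h1 : i1 + n1 <= k * a by case: h1 => //; lia.
have {}h2 : i2 + n2 <= k * b by case: h2 => //; lia.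
have : k * (a + b) <= k * c by rewrite e2 leq_mul2l leq_addr orbT.
by rewrite mulnDr; lia.
Qed.

Definition big_atom (p : nat * nat) := exists i n,
  [/\ p = el c i n, i < m, 0 < n & k * c < i + n].

Definition small_atom (p : nat * nat) := exists a i n,
  [/\ p = el a i n, 0 < a, 0 < n, i + n <= k * a & a = 1 \/ n = 1].

Lemma atom_cases p : atoms S p -> big_atom p \/ small_atom p.
Proof.
move=> [Sp p0 irr]; have [a [i [n [def_p im n0 a0 h]]]] := leamerP Sp p0.
have [le|gt] := leqP (i + n) (k * a); last first.
  left; have ca : c <= a by case: h => //; lia.
  have [eq_a|ne_a] := eqVneq a c; first by exists i, n; rewrite -eq_a.
  have ca1 : k * c.+1 <= k * a by rewrite leq_mul2l; lia.
  (* Removing a level 1 atom leaves level at least [c], where membership is automatic. *)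
  case: irr; exists (el 1 0 1), (el a.-1 i n.-1); split; rewrite ?def_p ?elD.
  - by apply: leamer_el; lia.
  - by apply: leamer_el; lia.
  - exact: el_neq0.
  - by apply: el_neq0; lia.
  - by congr el; lia.
right; exists a, i, n; split=> //.
have [->|ne_a] := eqVneq a 1; first by left.
have [->|ne_n] := eqVneq n 1; first by right.
have aS : k * a = k + k * a.-1 by rewrite -mulnS prednK.
have [|||i1 [j1 [i2 [j2 [eI eJ h1 h2]]]]] := @interval_split k (k * a.-1) 1 i (i + n).
- by [].
- by rewrite muln_gt0; lia.
- lia.
case: irr; exists (el 1 i1 (j1 - i1)), (el a.-1 i2 (j2 - i2)).
split; rewrite ?def_p ?elD.
- by apply: leamer_el; lia.
- by apply: leamer_el; lia.
- by apply: el_neq0; lia.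
- by apply: el_neq0; lia.
- by congr el; lia.
Qed.

(** * Sums of atoms and explicit factorizations *)

Lemma sum_atoms (t : seq (nat * nat)) : (forall p, p \in t -> atoms S p) -> exists A I N,
  [/\ (\sum_(p <- t) p)%R = el A I N, size t <= A & size t <= N].
Proof.
elim: t => [_|p t IHt tA]; first by exists 0, 0, 0; rewrite big_nil.
have [q qt|A [I [N [e leA leN]]]] := IHt; first by apply: tA; rewrite inE qt orbT.
have [Sp p0 _] : atoms S p by apply: tA; rewrite inE eqxx.
have [a [i [n [-> _ n0 a0 _]]]] := leamerP Sp p0.
by exists (a + A), (i + I), (n + N); rewrite big_cons e elD /=; split=> //; lia.
Qed.

(* The last alternative: an atom of level a > 1 contributes only 1 to N, and
   every other one at most k. *)
Lemma sum_small_atoms (t : seq (nat * nat)) : (forall p, p \in t -> small_atom p) ->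
  exists A I N,
  [/\ (\sum_(p <- t) p)%R = el A I N, size t <= A, size t <= N,
      I + N <= k * A &
      N <= k * size t /\ (size t = A \/ N + k <= 1 + k * size t)].
Proof.
elim: t => [_|p t IHt tA].
  by exists 0, 0, 0; rewrite big_nil; split=> //; split=> //; left.
have [q qt|A [I [N [e leA leN leIN [Nt h]]]]] := IHt.
  by apply: tA; rewrite inE qt orbT.
have [a [i [n [-> a0 n0 le1 h1]]]] : small_atom p by apply: tA; rewrite inE eqxx.
exists (a + A), (i + I), (n + N); rewrite big_cons e elD /= mulnS mulnDr.
by split=> //; lia.
Qed.

Lemma lengths_level1 r I J :
  I + r <= J <= k * r -> lengths S (el r I (J - I)) r.
Proof.
elim: r I J => [|r IHr] I J h.
  have [-> ->] : I = 0 /\ J = 0 by lia.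
  exact: lengths0.
have [||i1 [j1 [i2 [j2 [-> -> h1 h2]]]]] :=
  @interval_split k (k * r) r I J k_gt0.
- by rewrite leq_pmull.
- by move: h; rewrite mulnS; lia.
have -> : el r.+1 (i1 + i2) (j1 + j2 - (i1 + i2)) =
    (el 1 i1 (j1 - i1) + el r i2 (j2 - i2))%R.
  by rewrite elD; congr el; lia.
by apply: lengths_cons (IHr _ _ h2); apply: atom_level1; lia.
Qed.

Lemma lengths_unit_level1 r A I N : r < A -> r < N -> I + N <= k * A ->
  N <= 1 + k * r -> lengths S (el A I N) r.+1.
Proof.
move=> rA rN IN Nr.
have kA : k * A = k * (A - r) + k * r by rewrite -mulnDr subnK // ltnW.
have kAr : 0 < k * (A - r) by rewrite muln_gt0 subn_gt0 k_gt0.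
(* The atom with n = 1 takes as much of [I] as level [A - r] allows, so the remainder fits in [r]
   atoms of level 1. *)
pose u := minn I (k * (A - r) - 1).
have -> : el A I N = (el (A - r) u 1 + el r (I - u) (I + N - u - 1 - (I - u)))%R.
  by rewrite elD; congr el; rewrite /u; lia.
apply: lengths_cons; last by apply: lengths_level1; rewrite /u; lia.
by apply/atom_unit/leamer_el => //; left; rewrite /u; lia.
Qed.

Lemma lengths_big_units r A I N : I < m -> c + r < A -> r.+1 < N ->
  k * c + r.+1 < I + N -> lengths S (el A I N) r.+2.
Proof.
move=> Im cA rN J.
have muln_unit q : (el 1 0 1 *+ q = el q 0 q)%R.
  elim: q => [|q IHq]; first by rewrite GRing.mulr0n.
  by rewrite GRing.mulrS IHq elD.
have -> : el A I N = (el 1 0 1 *+ r + (el (A - c - r) 0 1 + el c I (N - r.+1)))%R.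
  by rewrite muln_unit !elD; congr el; lia.
rewrite -[r.+2]addn2; apply: lengths_muln; first by apply: atom_level1.
apply: lengths_cons; last by apply/lengths1/atom_big; lia.
apply/atom_unit/leamer_el => //; left; rewrite muln_gt0; lia.
Qed.

(** * Upper bound for the gaps *)

Lemma big_atom_merge (t : seq (nat * nat)) p : (forall q, q \in t -> atoms S q) ->
  p \in t -> big_atom p -> 2 < size t ->
  lengths S (\sum_(q <- t) q)%R (size t).-1.
Proof.
move=> tA pt [i [n [def_p im n0 lt]]] t3.
have pt_perm := perm_to_rem pt.
have remA q : q \in rem p t -> atoms S q by move/mem_rem; exact: tA.
rewrite (perm_big _ pt_perm) big_cons (perm_size pt_perm) /=.
have : 1 < size (rem p t) by rewrite size_rem // ltn_predRL.
case: (rem p t) remA => [|y [|z t']] // remA _; rewrite !big_cons.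
have [Sy y0 _] : atoms S y by apply: remA; rewrite !inE eqxx.
have [Sz z0 _] : atoms S z by apply: remA; rewrite !inE eqxx orbT.
have Syz : S (y + z)%R.
  by apply: (proj2 (leamer_submonoid _ (generated_submonoidP _))).
move: Syz; have [a [i1 [n1 [-> _ n10 a0 _]]]] := leamerP Sy y0.
have [b [i2 [n2 [-> _ n20 b0 _]]]] := leamerP Sz z0.
rewrite elD => -[[_ e]|[_ Syz]]; first by lia.
have -> : (p + (el a i1 n1 + (el b i2 n2 + \sum_(q <- t') q)) =
  el c i (n + (n1 + n2).-1) + (el (a + b) (i1 + i2) 1 + \sum_(q <- t') q))%R.
  by rewrite def_p !GRing.addrA !elD; congr (el _ _ _ + _)%R; lia.
apply: lengths_cons; first by apply: atom_big; lia.
apply: lengths_cons.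
  by apply: atom_unit; right; split=> // j j1; apply: Syz => /=; move: j1 => /=; lia.
apply/lengthsP; exists t'; split=> // q qt'.
by apply: remA; rewrite !inE qt' !orbT.
Qed.

Lemma lengths_atom p r : atoms S p -> lengths S p r -> r = 1.
Proof.
move=> [Sp p0 irr] /lengthsP[[|y [|z t]] [tA <- def_p]] //.
  by case: p0; rewrite def_p big_nil.
case: irr; exists y, (\sum_(q <- z :: t) q)%R.
have [Sy y0 _] : atoms S y by apply: tA; rewrite !inE eqxx.
have rA q : q \in z :: t -> atoms S q by move=> qt; apply: tA; rewrite inE qt orbT.
split=> //; last by rewrite def_p big_cons.
  have [S0 SD] : submonoid S by apply/leamer_submonoid/generated_submonoidP.
  rewrite big_seq; apply: (big_ind (fun q => S q)) => // q qt.
  by have [] := rA q qt.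
by have [A [I [N [-> _ leN]]]] := sum_atoms rA;
  apply: el_neq0; apply: leq_trans leN.
Qed.

Lemma delta_le p d : S p -> delta_elt S p d -> d <= c.
Proof.
move=> Sp [l0 [l [hl0 hl lt_l gap ->]]]; rewrite leqNgt; apply/negP => gtc.
(* Zero and the atoms have only one length each; hence the larger length [l] is at least 3. *)
have l0_gt1 : 1 < l0.
  case: l0 hl0 {gap gtc} lt_l => [|[|//]] /lengthsP[t [tA + def_p]].
    move/size0nil => t0; move: def_p; rewrite t0 big_nil => p0 l_gt0.
    have /lengthsP[t' [t'A sz]] := hl; rewrite p0 => e.
    have [A [I [N [e' _ leN]]]] := sum_atoms t'A.
    rewrite sz in leN; have := @el_neq0 A I N (leq_trans l_gt0 leN).
    by rewrite -e' -e.
  case: t tA def_p => [|q [|? ?]] // tA; rewrite big_seq1 => def_p _ lt_l.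
  by move: hl lt_l; rewrite def_p => /(lengths_atom (tA q (mem_head _ _))) ->.
have /lengthsP[t [tA sz def_p]] := hl.
have [[q qt bq]|nbig] := pselect (exists2 q, q \in t & big_atom q).
  apply: (gap l.-1); first by lia.
  by rewrite def_p -sz; apply: big_atom_merge qt bq _ => //; rewrite sz; lia.
have tsmall q : q \in t -> small_atom q.
  by move=> qt; have [bq|//] := atom_cases (tA q qt); case: nbig; exists q.
have [A [I [N [def_el leA leN leIN _]]]] := sum_small_atoms tsmall.
rewrite sz in leA leN; rewrite def_el in def_p.
have [le|gt] := leqP N (1 + k * (l - 2)).
  apply: (gap l.-1); first by lia.
  have -> : l.-1 = (l - 2).+1 by lia.
  by rewrite def_p; apply: lengths_unit_level1; lia.
have p0 : p <> 0%R by rewrite def_p; apply: el_neq0; lia.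
have [a [i [n [def_p' im n0 a0 _]]]] := leamerP Sp p0.
have [w [_ ea en]] := el_inj im (etrans (esym def_p') def_p).
(* This is l - c, strictly between [l0] and [l] because the gap exceeds [c]. Passing to the
   representative with i < m only raises the level, so it stays at least [l]. *)
apply: (gap (l - c - 2).+2); first by lia.
have kl : k * (l - 2) = k * c + k * (l - c - 2) by rewrite -mulnDr; congr muln; lia.
have kl' : l - c - 2 <= k * (l - c - 2) by rewrite leq_pmull.
by rewrite def_p'; apply: lengths_big_units; lia.
Qed.

(** * Realization of every gap *)

Lemma delta_witness d : 0 < d <= c ->
  S (el (c + 2) (k * (c - d)) (k * d + 2)) /\
  delta_elt S (el (c + 2) (k * (c - d)) (k * d + 2)) d.
Proof.
move=> dc; split; first by apply: leamer_el; [lia | right; lia].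
have kc : k * c = k * (c - d) + k * d by rewrite -mulnDr subnK //; lia.
have kd : k <= k * d by rewrite leq_pmulr; lia.
(* Here i + n = k c + 2 leaves room for a big atom and just one atom with n = 1, while n = k d + 2
   is one too many for [d] atoms of level 1 and one with n = 1. *)
exists 2, (d + 2); split; last by lia.
- by apply: lengths_big_units; lia.
- have dkd : d <= k * d by rewrite leq_pmull.
  by rewrite [d + 2]addn2; apply: lengths_unit_level1; rewrite ?mulnDr ?mulnS; lia.
- lia.
move=> l hl /lengthsP[t [tA sz]].
have im : k * (c - d) < m by lia.
(* Beside a big atom, at least two further factors would add 2 or more to i + n, exceeding k c +
   2. *)
have [[q qt [i [n [def_q _ n0 lt]]]]|nbig] := pselect (exists2 q, q \in t & big_atom q).
  have remA p : p \in rem q t -> atoms S p by move/mem_rem; exact: tA.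
  have [A [I [N [e leA leN]]]] := sum_atoms remA.
  rewrite size_rem // sz in leA leN.
  rewrite (perm_big _ (perm_to_rem qt)) big_cons /= e def_q elD.
  move=> /(el_inj im)[w [e1 e2 e3]].
  have ws : w * s = 0 by lia.
  have w0 : w = 0 by move/eqP: ws; rewrite muln_eq0; lia.
  by rewrite w0 in e1; lia.
have tsmall q : q \in t -> small_atom q.
  by move=> qt; have [bq|//] := atom_cases (tA q qt); case: nbig; exists q.
have [A [I [N [-> leA leN leIN [_ h]]]]] := sum_small_atoms tsmall.
rewrite sz in leA leN h.
move=> /(el_inj im)[w [e1 e2 e3]].
have kA : k * A + k * (w * s) = k * c + k * 2 by rewrite -!mulnDr e2.
(* Each wrap adds m > k to [I] and lowers k A by k s >= k, more than the available slack 2 k - 2. *)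
have w0 : w = 0.
  case: w e1 e2 kA => // w e1 e2 kA; exfalso.
  have : k * 1 <= k * (w.+1 * s) by rewrite leq_mul2l muln_gt0 s_gt0 orbT.
  by move: e1; rewrite mulSn; lia.
rewrite w0 in e1 e2.
(* As l < d + 2 <= [A], some atom has level above 1, so N + k <= 1 + k l, which fails for N = k d +
   2. *)
have : k * l <= k * d.+1 by rewrite leq_mul2l; lia.
by rewrite mulnS; lia.
Qed.

End ArithmeticalLeamer.

Theorem theorem4p5 (m k s : nat) (hk : 1 <= k <= m - 1) (hms : coprime m s) :
  delta_set (arith_leamer m k s) = [set d | 1 <= d <= (m - 2) %/ k + 1].
Proof.
apply/seteqP; split=> [d [p Sp dp]|d dc] /=.
  rewrite (delta_le hk hms Sp dp) andbT.
  by case: dp => l [l' [_ _ lt _ ->]]; rewrite subn_gt0.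
have [Sp dp] := delta_witness hk hms dc.
by exists (((m - 2) %/ k + 1 + 2) * m + k * ((m - 2) %/ k + 1 - d) * s, k * d + 2).
Qed.
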